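(* Let $A\in\mathbb{R}^{n\times n}$ be symmetric, let $f$ be a real function defined on the spectrum of $A$, let $d\geq 1$ be an integer, and let $C_1,\dots,C_m$ be a distance-$d$ coloring of $\mathcal{G}(A)$. Let $\mathcal{N}=(N_1,\dots,N_m)$ be a tuple of positive integers, for each $\ell$ let $\boldsymbol{w}_\ell^{(1)},\dots,\boldsymbol{w}_\ell^{(N_\ell)}$ be Rademacher probing vectors associated with $C_\ell$, all of these vectors (over all $\ell$ and all samples) being independent, and let $$\mathcal{T}_d^{\mathcal{N}}(f(A))=\sum_{\ell=1}^m\frac1{N_\ell}\sum_{s=1}^{N_\ell}(\boldsymbol{w}_\ell^{(s)})^Tf(A)\boldsymbol{w}_\ell^{(s)}$$ be the corresponding Rademacher probing approximation of $\operatorname{tr}(f(A))$. Then $$\mathbb{V}[\mathcal{T}_d^{\mathcal{N}}(f(A))]=\sum_{\ell=1}^m\frac{V_\ell}{N_\ell}=2\sum_{\ell=1}^m\frac1{N_\ell}\|\operatorname{Off}([f(A)]_{C_\ell})\|_F^2,$$ where $V_\ell=2\|\operatorname{Off}([f(A)]_{C_\ell})\|_F^2=2\sum_{i,j\in C_\ell,\,i\ne j}|[f(A)]_{ij}|^2$.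
   Context: For symmetric $A$, $f(A)$ is the matrix function defined through the spectral decomposition. $\mathbb{V}$ denotes variance. $[M]_{ij}$ is the $(i,j)$ entry of $M$, $[M]_{\mathcal{I}}$ is the submatrix of $M$ with rows and columns indexed by $\mathcal{I}$, $\operatorname{Off}(M)$ is the off-diagonal part of $M$ (diagonal replaced by zeros), and $\|\cdot\|_F$ is the Frobenius norm. $\mathcal{G}(A)=(V,E)$ is the undirected graph with $V=\{1,\dots,n\}$ and $E=\{(i,j): i\ne j,\ [A]_{ij}\ne 0\}$; $\mathrm{d}(i,j)$ is the geodesic (shortest path) distance in $\mathcal{G}(A)$ ($\infty$ if there is no path). A distance-$d$ coloring with $m$ colors is a partition of $V$ of the form $C_\ell=\{i:\operatorname{col}(i)=\ell\}$, $\ell=1,\dots,m$, for a map $\operatorname{col}:V\to\{1,\dots,m\}$ satisfying $\operatorname{col}(i)\ne\operatorname{col}(j)$ whenever $i\ne j$ and $\mathrm{d}(i,j)\le d$. A Rademacher probing vector associated with $C_\ell$ is a random vector $\sum_{i\in C_\ell}X_i\boldsymbol{e}_i\in\mathbb{R}^n$, where $\boldsymbol{e}_i$ is the $i$th canonical basis vector and the $X_i$ are i.i.d. taking the values $\pm1$ with probability $\tfrac12$ each. *)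

(* Defs.v *)
From HB Require Import structures.
From mathcomp Require Import all_boot all_order all_algebra.
From mathcomp Require Import complex ring.
From mathcomp Require Import all_classical all_reals all_analysis.

Set Implicit Arguments.
Unset Strict Implicit.
Unset Printing Implicit Defensive.

Import Order.TTheory GRing.Theory Num.Theory.

Local Open Scope classical_set_scope.
Local Open Scope ring_scope.

Section matrix_function.
Context {R : realType}.

Definition orthogonal_mx n (Q : 'M[R]_n) := Q *m Q^T = 1%:M.

Definition spectral_decomposition n (A Q : 'M[R]_n) (D : 'rV[R]_n) :=
  orthogonal_mx Q /\ A = Q *m diag_mx D *m Q^T.

(* The value is 0 when A has no spectral decomposition, i.e. when A is not
   symmetric; for symmetric A, see [spectral_theorem] and [matfunE].  Only the
   values of f at the eigenvalues of A matter, so a function given on the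
   spectrum alone is represented by any of its extensions to R. *)
Definition matfun (f : R -> R) n (A : 'M[R]_n) : 'M[R]_n :=
  xget 0 [set B | exists Q D, spectral_decomposition A Q D /\
                              B = Q *m diag_mx (map_mx f D) *m Q^T].

Lemma spectral_decomposition_uniq (f : R -> R) n (A Q1 Q2 : 'M[R]_n) D1 D2 :
  spectral_decomposition A Q1 D1 -> spectral_decomposition A Q2 D2 ->
  Q1 *m diag_mx (map_mx f D1) *m Q1^T = Q2 *m diag_mx (map_mx f D2) *m Q2^T.
Proof.
move=> -[q1 e1] -[q2 e2].
have q1' := mulmx1C q1; have q2' := mulmx1C q2.
pose W := Q2^T *m Q1.
have eW : W *m diag_mx D1 = diag_mx D2 *m W.
  have -> : W *m diag_mx D1 = Q2^T *m A *m Q1.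
    by rewrite e1 !mulmxA -(mulmxA _ Q1^T) q1' mulmx1.
  by rewrite e2 [W]lock !mulmxA q2' mul1mx -lock /W !mulmxA.
have eWf : W *m diag_mx (map_mx f D1) = diag_mx (map_mx f D2) *m W.
  rewrite mul_mx_diag mul_diag_mx; apply/matrixP => i j; rewrite !mxE.
  move/matrixP/(_ i j): eW; rewrite mul_mx_diag mul_diag_mx !mxE mulrC => eW.
  have [->|W0] := eqVneq (\sum_k Q2^T i k * Q1 k j) 0; first by rewrite mul0r mulr0.
  by rewrite mulrC; congr (f _ * _); apply: (mulIf W0).
have WW : W *m W^T = 1%:M.
  by rewrite /W trmx_mul trmxK mulmxA -(mulmxA _ Q1) q1 mulmx1.
have -> : Q1 = Q2 *m W by rewrite /W mulmxA q2 mul1mx.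
clearbody W; rewrite trmx_mul -(mulmxA Q2 W) eWf -!mulmxA (mulmxA W) WW.
by rewrite mul1mx.
Qed.

Lemma matfunE (f : R -> R) n (A Q : 'M[R]_n) (D : 'rV[R]_n) :
  spectral_decomposition A Q D ->
  matfun f A = Q *m diag_mx (map_mx f D) *m Q^T.
Proof.
move=> sA; apply: xget_unique; first by exists Q, D.
by move=> B [Q' [D' [sA' ->]]]; exact: spectral_decomposition_uniq sA' sA.
Qed.

Lemma symmetric_eigenvalue n (A : 'M[R]_n.+1) :
  A^T = A -> exists a, eigenvalue A a.
Proof.
move=> sA.
pose toC := real_complex R.
pose B := map_mx toC A.
have [a /eigenvalueP[v vB v0]] := eigenvalue_closed B (ltn0Sn n).
pose vc := map_mx (@complex.conjc R) v.
have Bc : map_mx (@complex.conjc R) B = B.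
  by apply/matrixP => i j; rewrite !mxE complex.conjc_real.
have vcB : vc *m B = complex.conjc a *: vc.
  by rewrite -[in LHS]Bc -map_mxM vB map_mxZ.
have BT : B^T = B by rewrite /B map_trmx sA.
have h1 : v *m B *m vc^T = a *: (v *m vc^T) by rewrite vB scalemxAl.
have h2 : v *m B *m vc^T = complex.conjc a *: (v *m vc^T).
  rewrite -[in LHS]BT -mulmxA -trmx_mul vcB linearZ /= -scalemxAr.
  by [].
have nz : (v *m vc^T) 0 0 != 0.
  rewrite mxE psumr_neq0 => [|i _]; last by rewrite !mxE complex.mulcJ_ge0.
  have [i vi] : exists i, v 0 i != 0 by apply/rV0Pn.
  apply/hasP; exists i; rewrite ?mem_index_enum//=.
  rewrite lt_neqAle !mxE complex.mulcJ_ge0 andbT eq_sym mulf_neq0//.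
  by rewrite complex.conjc_eq0.
have ar : a = complex.conjc a.
  apply: (mulIf nz); move: h2; rewrite h1 => /matrixP/(_ 0 0).
  by rewrite !mxE.
have [x ax] : exists x, a = toC x.
  case: a ar {vB vcB h1 h2} => x y [] /eqP; rewrite eq_sym eqNr => /eqP ->.
  by exists x.
exists x; rewrite eigenvalue_root_char -(fmorph_root toC) map_char_poly /=.
rewrite -eigenvalue_root_char.
by apply/eigenvalueP; exists v => //; rewrite vB ax.
Qed.

Lemma orthogonal_with_row n (u : 'rV[R]_n.+1) :
  (u *m u^T) 0 0 = 1 -> exists Q : 'M[R]_n.+1, orthogonal_mx Q /\ row 0 Q = u.
Proof.
move=> uu; pose e : 'rV[R]_n.+1 := delta_mx 0 0.
have scal (M : 'M[R]_1) : M = (M 0 0)%:M := mx11_scalar M.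
have uuM : u *m u^T = 1%:M by rewrite [LHS]scal uu.
have eeM : e *m e^T = 1%:M.
  by rewrite /e trmx_delta mul_delta_mx [LHS]scal !mxE !eqxx.
have [->|ue] := eqVneq u e.
  exists 1%:M; split; first by rewrite /orthogonal_mx trmx1 mulmx1.
  by rewrite rowE mulmx1.
have ueM : u *m e^T = (u 0 0)%:M.
  by rewrite [LHS]scal /e trmx_delta -colE !mxE.
have euM : e *m u^T = (u 0 0)%:M by rewrite [LHS]scal /e -rowE !mxE.
pose w := u - e; pose c := 1 - u 0 0.
have ewM : e *m w^T = (- c)%:M.
  by rewrite /w linearB /= mulmxBr eeM euM -raddfB /c opprB.
have wwM : w *m w^T = (2 * c)%:M.
  rewrite {1}/w mulmxBl ewM /w linearB /= mulmxBr uuM ueM -!raddfB /=.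
  by congr (_%:M); rewrite -/c opprK mulr_natl mulr2n.
have c0 : c != 0.
  apply: contra_neq ue => c0; apply/eqP; rewrite -subr_eq0 -/w; apply/eqP.
  have ww0 : \sum_j w 0 j ^+ 2 = 0.
    move/matrixP/(_ 0 0): wwM; rewrite c0 mulr0 mxE [RHS]mxE mul0rn => ww0; rewrite -[RHS]ww0.
    by apply: eq_bigr => j _; rewrite [w^T _ _]mxE.
  apply/rowP => i; rewrite [RHS]mxE; apply/eqP; rewrite -sqrf_eq0; apply/eqP.
  by apply: (psumr_eq0P _ ww0) => // j _; exact: sqr_ge0.
pose K := w^T *m w; pose H := 1%:M - c^-1 *: K.
have KT : K^T = K by rewrite /K trmx_mul trmxK.
have KK : K *m K = (2 * c) *: K.
  by rewrite {1}/K -mulmxA (mulmxA w) wwM mul_scalar_mx -scalemxAr.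
have eK : e *m K = - c *: w by rewrite /K mulmxA ewM mul_scalar_mx.
have we : e + w = u by rewrite /w addrC subrK.
clearbody K w; exists H; split.
  have HT : H^T = H.
    by apply/matrixP => i j; rewrite /H -[in RHS]KT !mxE [i == j]eq_sym.
  rewrite /orthogonal_mx HT /H.
  rewrite mulmxBl mul1mx mulmxBr mulmx1 -scalemxAr -scalemxAl KK !scalerA.
  rewrite (_ : c^-1 * c^-1 * (2 * c) = c^-1 + c^-1).
    by rewrite scalerDl opprB addrK subrK.
  by field.
rewrite rowE -/e /H mulmxBr mulmx1 -scalemxAr eK.
by rewrite scalerA mulrN mulVf// scaleN1r opprK.
Qed.

Theorem spectral_theorem n (A : 'M[R]_n) :
  A^T = A -> exists Q D, spectral_decomposition A Q D.
Proof.
elim: n A => [|n IHn] A sA.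
  by exists 1%:M, 0; split; rewrite /orthogonal_mx; apply/matrixP => -[].
have [a /eigenvalueP[v vA v0]] := symmetric_eigenvalue sA.
pose s := (v *m v^T) 0 0.
have s_gt0 : 0 < s.
  have [i vi] := rV0Pn _ v0.
  rewrite /s mxE (bigD1 i)//= mxE -expr2 ltr_pwDl//.
    by rewrite lt_neqAle eq_sym sqrf_eq0 vi sqr_ge0.
  by apply: sumr_ge0 => j _; rewrite mxE -expr2 sqr_ge0.
pose u := (Num.sqrt s)^-1 *: v.
have uu : (u *m u^T) 0 0 = 1.
  have -> : u *m u^T = s^-1 *: (v *m v^T).
    rewrite /u -scalemxAl [X in _ *: (_ *m X)]linearZ /= -scalemxAr scalerA.
    by rewrite -invfM -expr2 sqr_sqrtr ?ltW.
  by rewrite mxE -/s mulVf// gt_eqF.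
have uA : u *m A = a *: u by rewrite /u -scalemxAl vA !scalerA mulrC.
have [H [HH Hu]] := orthogonal_with_row uu.
have HH' := mulmx1C HH.
pose M : 'M[R]_(1 + n) := H *m A *m H^T.
have MT : M^T = M by rewrite /M !trmx_mul trmxK sA mulmxA.
have M0 j : M 0 j = a *+ (j == 0).
  have /rowP/(_ j) : row 0 M = a *: row 0 1%:M.
    by rewrite /M !row_mul Hu uA -scalemxAl -Hu -row_mul HH.
  by rewrite !mxE eq_sym mulr_natr.
have AE : A = H^T *m M *m H.
  by rewrite /M !mulmxA HH' mul1mx -mulmxA HH' mulmx1.
clearbody M.
have Mj i : M i 0 = a *+ (i == 0) by rewrite -M0 -[in LHS]MT mxE.
have BT : (drsubmx M)^T = drsubmx M by rewrite trmx_drsub MT.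
have [U [D [UU BU]]] := IHn _ BT.
have l0 : lshift n 0 = 0 :> 'I_(1 + n) by apply: val_inj.
have ME : M = block_mx a%:M 0 0 (drsubmx M).
  rewrite -[LHS]submxK; congr block_mx; apply/matrixP => i j.
  - by rewrite !mxE !ord1 l0 M0 eqxx.
  - by rewrite !mxE !ord1 l0 M0.
  - by rewrite !mxE !ord1 l0 Mj.
pose V : 'M[R]_(1 + n) := block_mx 1%:M 0 0 U.
have VV : V *m V^T = 1%:M.
  rewrite /V tr_block_mx !trmx0 trmx1 mulmx_block !mulmx0 !mul0mx !addr0 add0r.
  by rewrite mulmx1 UU -scalar_mx_block.
have MV : M = V *m diag_mx (row_mx a%:M D) *m V^T.
  rewrite ME BU diag_mx_row /V tr_block_mx !trmx0 trmx1 !mulmx_block.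
  rewrite !(mulmx0, mul0mx, addr0, add0r) mul1mx mulmx1.
  congr (block_mx _ _ _ _); apply/matrixP => i j.
  by rewrite !ord1 !mxE eqxx.
clearbody V; exists (H^T *m V), (row_mx a%:M D); split.
  by rewrite /orthogonal_mx trmx_mul trmxK mulmxA -(mulmxA _ V) VV mulmx1.
by rewrite AE MV trmx_mul trmxK !mulmxA.
Qed.

End matrix_function.

Section matrix_notions.
Context {R : realType}.

Definition offdiag n (M : 'M[R]_n) : 'M[R]_n :=
  \matrix_(i, j) if i == j then 0 else M i j.

Definition principal_submx n (I : {set 'I_n}) (M : 'M[R]_n) : 'M[R]_#|I| :=
  mxsub (@enum_val _ (mem I)) (@enum_val _ (mem I)) M.

Definition frobenius_norm m n (M : 'M[R]_(m, n)) : R :=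
  Num.sqrt (\sum_i \sum_j `|M i j| ^+ 2).

End matrix_notions.

Section graph.
Context {R : realType} {n : nat}.
Implicit Type A : 'M[R]_n.

Definition edge A : rel 'I_n := fun i j => (i != j) && (A i j != 0).

(* The infimum of the lengths of the walks from i to j; it is +oo when there
   is no such walk. *)
Definition geodesic_distance A (i j : 'I_n) : \bar R :=
  ereal_inf [set (size p)%:R%:E | p in
             [set p : seq 'I_n | path (edge A) i p /\ last i p = j]].

Definition distance_coloring A (d m : nat) (col : 'I_n -> 'I_m) :=
  forall i j, i != j -> (geodesic_distance A i j <= d%:R%:E)%E ->
  col i != col j.

Definition color_class m (col : 'I_n -> 'I_m) (l : 'I_m) : {set 'I_n} :=
  [set i | col i == l]%SET.

End graph.

Section probing.
Context {disp : measure_display} {T : measurableType disp} {R : realType}.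
Variable P : probability T R.

(* Mutual independence of the classes of events F i for i in D. *)
Definition mutually_independent (I : finType) (D : {set I})
    (F : I -> set (set T)) :=
  forall (J : {set I}) (E : I -> set T), J \subset D ->
    (forall i, i \in J -> F i (E i)) ->
    (P (\bigcap_(i in [set` J]) E i) = \prod_(i in J) P (E i))%E.

Definition independent_variables (I : finType) (D : {set I})
    (X : I -> T -> R) :=
  mutually_independent D
    (fun i => preimage_set_system setT (X i) measurable).

(* The sigma-algebra generated by a random vector is the one generated by its
   coordinates. *)
Definition independent_vectors (I : finType) n (w : I -> T -> 'cV[R]_n) :=
  mutually_independent [set: I]%SET
    (fun k => g_sigma_preimage (fun i t => w k t i 0 : R)).

Definition rademacher (X : T -> R) :=
  P (X @^-1` [set 1]) = (2^-1)%:E /\ P (X @^-1` [set -1]) = (2^-1)%:E.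

Definition rademacher_probing_vector n (C : {set 'I_n})
    (w : T -> 'cV[R]_n) :=
  exists X : 'I_n -> {RV P >-> R},
    [/\ independent_variables C (fun i => X i : T -> R),
        forall i, i \in C -> rademacher (X i) &
        forall t, w t = \sum_(i in C) X i t *: delta_mx i 0].

Definition probing_estimator n m (N : 'I_m -> nat)
    (w : forall l : 'I_m, 'I_(N l) -> T -> 'cV[R]_n) (M : 'M[R]_n) (t : T) : R :=
  \sum_l (N l)%:R^-1 * \sum_(s < N l) ((w l s t)^T *m M *m w l s t) 0 0.

End probing.

(* Main.v *)
(* Off the null event where some coordinate is not +1 or -1, the coordinates of
   all the probing vectors form one uniformly distributed point of a hypercube,
   and the estimator is a single quadratic form on that hypercube: its matrix is
   block diagonal, with one block f(A)_{C_l} / N_l per sample.  The characters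
   x_i x_j with i != j have mean zero, and two of them are orthogonal unless
   they come from the same unordered pair, so the variance of a symmetric
   quadratic form is twice the sum of its squared off-diagonal entries. *)
Require Import Defs.
From mathcomp Require Import all_boot all_order all_algebra.
From mathcomp Require Import ring.
From mathcomp Require Import all_classical all_reals all_analysis.
From mathcomp Require Import measurable_realfun.
Import Order.TTheory GRing.Theory Num.Theory.
Set Implicit Arguments.
Unset Strict Implicit.
Unset Printing Implicit Defensive.
Local Open Scope classical_set_scope.
Local Open Scope ring_scope.

(** * Moments of quadratic forms on a finite hypercube *)

Section hypercube.
Context {R : numFieldType} {I : finType}.
Implicit Types (S D : {set I}) (A : I -> I -> R).

(* A set S encodes the vertex of the hypercube that is 1 on S and -1 off S. *)
Definition hsign S (i : I) : R := if i \in S then 1 else -1.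

(** Symmetric difference with the singleton of [a], that is, the reflection of the hypercube that
    negates coordinate [a]. *)
Definition flip (a : I) S : {set I} := if a \in S then S :\ a else (a |: S)%SET.

Definition quadratic_form A D (x : I -> R) : R :=
  \sum_(i in D) \sum_(j in D) A i j * x i * x j.

Lemma hsignK S i : hsign S i * hsign S i = 1.
Proof. by rewrite /hsign; case: ifP => _; rewrite ?mulrNN mulr1. Qed.

Lemma in_flip a S i : (i \in flip a S) = (i == a) (+) (i \in S).
Proof.
by rewrite /flip; case: ifP => aS; rewrite !inE; case: eqVneq => [->|]; rewrite ?aS.
Qed.

Lemma flipK a : involutive (flip a).
Proof. by move=> S; apply/setP => i; rewrite !in_flip addbA addbb. Qed.

Lemma flip_subset a D S : a \in D -> (flip a S \subset D) = (S \subset D).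
Proof.
move=> aD; suff sub S' : S' \subset D -> flip a S' \subset D.
  by apply/idP/idP => [/sub|/sub //]; rewrite flipK.
move=> /fintype.subsetP sD; apply/fintype.subsetP => i.
by rewrite in_flip; case: eqVneq => [->//|_ /sD].
Qed.

Lemma hsign_flip a S i :
  hsign (flip a S) i = if i == a then - hsign S i else hsign S i.
Proof. by rewrite /hsign in_flip; case: (i == a); case: (i \in S); rewrite //= opprK. Qed.

(** As [a] lies in [D], [flip a] permutes the subsets of [D]; reindexing along it turns the sum into
    its own opposite. *)
Lemma sum_flip_eq0 D a (F : {set I} -> R) : a \in D ->
  (forall S, F (flip a S) = - F S) -> \sum_(S : {set I} | S \subset D) F S = 0.
Proof.
move=> aD Fa; apply/eqP; rewrite -eqNr -sumrN; apply/eqP.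
rewrite [RHS](reindex_inj (inv_inj (flipK a))) /=.
by apply: eq_big => S; rewrite ?flip_subset// Fa.
Qed.

Lemma sum_hsign2 D i j : i \in D -> i != j ->
  \sum_(S : {set I} | S \subset D) hsign S i * hsign S j = 0.
Proof.
move=> iD ij; apply: (sum_flip_eq0 iD) => S.
by rewrite !hsign_flip eqxx eq_sym (negbTE ij) mulNr.
Qed.

Lemma sum_subset_cst D (x : R) :
  \sum_(S : {set I} | S \subset D) x = 2 ^+ #|D| * x.
Proof.
rewrite (eq_bigl (fun S => S \in powerset D)) => [|S]; last by rewrite powersetE.
by rewrite sumr_const card_powerset -[LHS]mulr_natl natrX.
Qed.

(** Since [i != j] and [k != l], either the two pairs agree up to order and the product is
    constantly 1, or one of [i], [j] occurs exactly once among the four indices and flipping it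
    negates the product. At most one of the two indicators is 1. *)
Lemma sum_hsign4 D i j k l : i \in D -> j \in D -> i != j -> k != l ->
  \sum_(S : {set I} | S \subset D) hsign S i * hsign S j *
    (hsign S k * hsign S l) =
  2 ^+ #|D| * (((i, j) == (k, l))%:R + ((i, j) == (l, k))%:R).
Proof.
move=> iD jD ij kl; rewrite !xpair_eqE.
have [jl|] := eqVneq j l; have [ik|] := eqVneq i k => /=.
- subst k l; rewrite (negbTE ij) addr0 -sum_subset_cst.
  by apply: eq_bigr => S _; rewrite mulrACA !hsignK mulr1.
- subst l => nik; rewrite (negbTE ij) addr0 mulr0; apply: (sum_flip_eq0 iD) => S.
  by rewrite !hsign_flip !eqxx (eq_sym k) (eq_sym j) (negbTE ij) (negbTE nik) !mulNr.
- subst k => njl; rewrite (negbTE kl) addr0 mulr0; apply: (sum_flip_eq0 jD) => S.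
  by rewrite !hsign_flip !eqxx (negbTE ij) (eq_sym l) (negbTE njl) mulrN mulNr.
move=> nik njl; have [il|] := eqVneq i l; have [jk|] := eqVneq j k => /=.
- subst k l; rewrite add0r -sum_subset_cst; apply: eq_bigr => S _.
  by rewrite (mulrC (hsign S j)) mulrACA !hsignK mulr1.
- subst l => njk; rewrite addr0 mulr0; apply: (sum_flip_eq0 jD) => S.
  by rewrite !hsign_flip !eqxx (negbTE ij) (eq_sym k) (negbTE njk) mulrN mulNr.
- subst k => nil; rewrite addr0 mulr0; apply: (sum_flip_eq0 iD) => S.
  by rewrite !hsign_flip !eqxx (eq_sym j) (negbTE ij) (eq_sym l) (negbTE nil) !mulNr.
move=> njk nil; rewrite addr0 mulr0; apply: (sum_flip_eq0 iD) => S.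
rewrite !hsign_flip eqxx (eq_sym j) (eq_sym k) (eq_sym l).
by rewrite (negbTE ij) (negbTE nik) (negbTE nil) !mulNr.
Qed.

Lemma pow2_neq0 D : 2 ^+ #|D| != 0 :> R.
Proof. by rewrite expf_neq0// pnatr_eq0. Qed.

Let offpair D (p : I * I) := (p.1 \in D) && ((p.2 \in D) && (p.1 != p.2)).

(** Squares of signs are 1, so the diagonal contributes a constant; the characters of the
    off-diagonal pairs carry all the fluctuation. *)
Lemma quadratic_form_hsign A D S :
  quadratic_form A D (hsign S) =
  \sum_(i in D) A i i +
  \sum_(p | offpair D p) A p.1 p.2 * (hsign S p.1 * hsign S p.2).
Proof.
rewrite -(pair_big_dep (mem D) (fun i j => (j \in D) && (i != j))
  (fun i j => A i j * (hsign S i * hsign S j)))/= -big_split/=.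
apply: eq_bigr => i iD; rewrite (bigD1 i)//= -mulrA hsignK mulr1; congr +%R.
by apply: eq_big => j; rewrite ?mulrA// eq_sym.
Qed.

Lemma mean_quadratic_form A D :
  \sum_(S : {set I} | S \subset D) 2 ^- #|D| * quadratic_form A D (hsign S) =
  \sum_(i in D) A i i.
Proof.
under eq_bigr do rewrite quadratic_form_hsign.
rewrite -mulr_sumr big_split/= sum_subset_cst exchange_big/= [X in _ + X]big1.
  by rewrite addr0 mulKf// pow2_neq0.
by move=> p /and3P[iD jD ij]; rewrite -mulr_sumr sum_hsign2// mulr0.
Qed.

Lemma variance_quadratic_form A D : (forall i j, A i j = A j i) ->
  \sum_(S : {set I} | S \subset D)
    2 ^- #|D| * (quadratic_form A D (hsign S) - \sum_(i in D) A i i) ^+ 2 =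
  2 * \sum_(i in D) \sum_(j in D | i != j) A i j ^+ 2.
Proof.
move=> symA; under eq_bigr do rewrite quadratic_form_hsign addrC addKr expr2 mulr_suml.
rewrite pair_big_dep/= -mulr_sumr exchange_big/= mulr_sumr [RHS]mulr_sumr.
apply: eq_bigr => -[i j] /and3P[/= iD jD ij].
under eq_bigr do rewrite mulr_sumr.
(* Orthogonality keeps only [p = (i, j)] and [p = (j, i)]. The second indicator is written
   [(j, i) == p] so that [pick] evaluates both sums; by symmetry of [A] they are equal, whence the
   factor 2. *)
rewrite exchange_big/= (eq_bigr (fun p => 2 ^+ #|D| * (A i j * A p.1 p.2 *
    (((i, j) == p)%:R + ((j, i) == p)%:R)))) => [|[k l] /and3P[/= kD lD kl]]; last first.
  rewrite [((j, i) == _)](_ : _ = ((i, j) == (l, k))); last first.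
    by rewrite !xpair_eqE andbC.
  rewrite mulrCA -sum_hsign4// [RHS]mulr_sumr.
  by apply: eq_bigr => S _; ring.
rewrite -mulr_sumr mulKf ?pow2_neq0//.
under eq_bigr do rewrite mulrDr.
rewrite big_split/=.
have pick a b : offpair D (a, b) ->
    \sum_(p | offpair D p) A i j * A p.1 p.2 * ((a, b) == p)%:R = A i j * A a b.
  move=> ab; rewrite (bigD1 (a, b))//= eqxx mulr1 big1 ?addr0// => p /andP[_].
  by rewrite eq_sym => /negbTE ->; rewrite mulr0.
rewrite !pick /offpair/= ?iD ?jD//; last by rewrite eq_sym.
by rewrite (symA j i); ring.
Qed.

End hypercube.

(** * From independent Rademacher variables to the uniform hypercube *)

Section rademacher_variables.
Context {disp : measure_display} {T : measurableType disp} {R : realType}.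
Variable P : probability T R.
Context {I : finType} (D : {set I}) (X : I -> T -> R).
Hypothesis mX : forall i, measurable_fun setT (X i).
Hypothesis indepX : independent_variables P D X.
Hypothesis radX : forall i, i \in D -> rademacher P (X i).

(** The event that the variables sit at the vertex [S]. It depends on [S] only through its trace on
    [D], hence the restriction to subsets of [D] below. *)
Definition cell (S : {set I}) : set T :=
  \bigcap_(i in [set` D]) X i @^-1` [set hsign S i].

Lemma measurable_cell S : measurable (cell S).
Proof.
apply: fin_bigcap_measurable => // i _.
by rewrite -[X in measurable X]setTI; exact: mX.
Qed.

Lemma probability_cell S : P (cell S) = (2 ^- #|D|)%:E.
Proof.
rewrite [LHS](@indepX D (fun i => X i @^-1` [set hsign S i]))//; last first.
  by move=> i _; exists [set hsign S i]; rewrite ?setTI.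
under eq_bigr => i iD.
  rewrite [P _](_ : _ = (2^-1)%:E); last first.
    by have [X1 XN1] := radX iD; rewrite /hsign; case: ifP.
  over.
by rewrite prodEFin prodr_const exprVn.
Qed.

Lemma trivIset_cell : trivIset [set` enum (powerset D)] cell.
Proof.
apply/trivIsetP => S S' /=; rewrite !mem_enum !powersetE => SD S'D.
apply: contra_neqP => /eqP/set0P[t [tS tS']]; apply/setP => i.
have [iD|iD] := boolP (i \in D); last first.
  by apply/idP/idP => [/(fintype.subsetP SD)|/(fintype.subsetP S'D)]; rewrite (negPf iD).
have : hsign S i = hsign S' i :> R by rewrite -[LHS](tS i iD) -[RHS](tS' i iD).
have N11 : (-1 : R) == 1 = false by rewrite eqNr oner_eq0.
by rewrite /hsign; do 2 case: ifP => //; move=> _ _ /eqP; rewrite ?N11// eq_sym N11.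
Qed.

(** The cells are disjoint, equally likely and of total probability 1, so [g] is almost surely a
    simple function and is integrated cell by cell. *)
Lemma expectation_cell (g : T -> R) (c : {set I} -> R) :
  measurable_fun setT g -> (forall S t, cell S t -> g t = c S) ->
  'E_P[g]%E = (\sum_(S : {set I} | S \subset D) 2 ^- #|D| * c S)%:E.
Proof.
move=> mg gc; rewrite unlock.
pose U := \big[setU/set0]_(S <- enum (powerset D)) cell S.
have mU : measurable U by apply: bigsetU_measurable => S _; exact: measurable_cell.
(* Taken for a general integrand: [h = 1] shows that the cells fill a set of probability 1, then
   [h = g] gives the expectation. *)
have intU h b : measurable_fun setT h -> (forall S t, cell S t -> h t = b S) ->
    (\int[P]_(t in U) (h t)%:E =
      (\sum_(S : {set I} | S \subset D) 2 ^- #|D| * b S)%:E)%E.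
  move=> mh hb; rewrite integral_bigsetU_EFin//=.
  - rewrite big_enum/= -sumEFin; apply: eq_big => S; rewrite ?powersetE// => _.
    rewrite (eq_integral (cst (b S)%:E)); last first.
      by move=> t /set_mem tS; rewrite (hb S t).
    rewrite integral_cst; last exact: measurable_cell.
    by rewrite [X in (_ * X)%E]probability_cell -EFinM mulrC.
  - exact: measurable_cell.
  - exact: enum_uniq.
  - exact: trivIset_cell.
  - by apply/measurable_EFinP; exact: measurable_funTS.
have PU : P U = 1%E.
  rewrite -[LHS]mul1e -integral_cst// (intU (cst 1) (fun=> 1))//.
  by rewrite -mulr_sumr sum_subset_cst mulr1 mulVf// pow2_neq0.
have mCU : measurable (~` U) by exact: measurableC.
have mg' (B : set T) : measurable_fun B (fun t => (g t)%:E).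
  by apply/measurable_EFinP; exact: measurable_funTS.
rewrite -(setUv U) integral_setU//; last by exact/disj_setPCl.
rewrite (intU g c)// null_set_integral ?adde0//.
by rewrite [LHS]probability_setC// PU subee.
Qed.

Lemma measurable_quadratic_form (A : I -> I -> R) :
  measurable_fun setT (fun t => quadratic_form A D (X^~ t)).
Proof.
rewrite /quadratic_form; under eq_fun do rewrite -big_enum/=.
apply: measurable_sum => i; under eq_fun do rewrite -big_enum/=.
apply: measurable_sum => j; apply: measurable_funM => //.
by apply: measurable_funM => //; exact: measurable_cst.
Qed.

Lemma variance_rademacher_quadratic_form (A : I -> I -> R) :
  (forall i j, A i j = A j i) ->
  'V_P[fun t => quadratic_form A D (X^~ t)] =
  (2 * \sum_(i in D) \sum_(j in D | i != j) A i j ^+ 2)%:E.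
Proof.
move=> symA; set q := fun t => _.
have mq : measurable_fun setT q by exact: measurable_quadratic_form.
have qS S t : cell S t -> q t = quadratic_form A D (hsign S).
  by move=> tS; apply: eq_bigr => i iD; apply: eq_bigr => j jD; rewrite tS// tS.
(* Once the mean is replaced by its hypercube value, the squared deviation is again constant on each
   cell, so the same formula computes its expectation. *)
rewrite /variance unlock (expectation_cell mq qS)/= mean_quadratic_form.
rewrite -(variance_quadratic_form D symA); apply: expectation_cell => [|S t tS].
  by apply: measurable_funM; apply: measurable_funB => //; exact: measurable_cst.
by rewrite expr2 -(qS S t tS).
Qed.

End rademacher_variables.

(** * Joint independence, matrix identities and coordinates of probing vectors *)

(** An intersection indexed by pairs is cut into slices [F k]. Each slice is a finite intersection,
    hence lies in the sigma-algebra generated by [w k]; independence of the vectors factors over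
    [k], and independence of the coordinates then factors each slice. *)
Lemma independent_variables_block {disp : measure_display}
    {T : measurableType disp} {R : realType} (P : probability T R)
    (K : finType) n (D : K -> {set 'I_n}) (w : K -> T -> 'cV[R]_n) :
  independent_vectors P w ->
  (forall k, independent_variables P (D k) (fun i t => w k t i 0)) ->
  independent_variables P [set x : K * 'I_n | x.2 \in D x.1]%SET
    (fun x t => w x.1 t x.2 0).
Proof.
move=> indepw indepk J E /fintype.subsetP sJ JE.
pose Jk k := [set i | (k, i) \in J]%SET.
pose F k := \bigcap_(i in [set` Jk k]) E (k, i).
have -> : \bigcap_(x in [set` J]) E x = \bigcap_(k in [set` [set: K]%SET]) F k.
  apply/seteqP; split=> t tE.
    by move=> k _ i /=; rewrite inE => kiJ; exact: tE.
  by move=> [k i] /= kiJ; apply: (tE k) => /=; rewrite inE.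
rewrite [LHS]indepw//; last first.
  move=> k _; rewrite /g_sigma_preimage; set G := \big[_/_]_(_ < _) _.
  apply: (@fin_bigcap_measurable _ (g_sigma_algebraType G)) => // i /=.
  rewrite inE => kiJ; apply: sub_sigma_algebra.
  by rewrite /G -bigcup_seq; exists i; [rewrite /= mem_index_enum|exact: JE kiJ].
under eq_bigr => k _.
  rewrite [P _](indepk k (Jk k) (fun i => E (k, i))); last 2 first.
  - by apply/fintype.subsetP => i; rewrite inE => /sJ; rewrite inE.
  - by move=> i; rewrite inE => /JE.
  over.
rewrite pair_big_dep/=; apply: eq_big => -[k i] //=.
by rewrite !inE.
Qed.

Lemma matfun_sym {R : realType} (f : R -> R) n (A : 'M[R]_n) :
  A^T = A -> (matfun f A)^T = matfun f A.
Proof.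
move=> /spectral_theorem[Q [D QD]]; rewrite (matfunE f QD).
by rewrite !trmx_mul trmxK tr_diag_mx mulmxA.
Qed.

Lemma frobenius_offdiag_principal {R : realType} n (C : {set 'I_n}) (M : 'M[R]_n) :
  frobenius_norm (offdiag (principal_submx C M)) ^+ 2 =
  \sum_(i in C) \sum_(j in C | i != j) `|M i j| ^+ 2.
Proof.
rewrite /frobenius_norm sqr_sqrtr; last first.
  by apply: sumr_ge0 => i _; apply: sumr_ge0 => j _; exact: sqr_ge0.
rewrite [RHS]big_enum_val/=; apply: eq_bigr => i _.
rewrite big_mkcondr/= [RHS]big_enum_val/=; apply: eq_bigr => j _.
rewrite !mxE (inj_eq enum_val_inj); case: eqP => //= _.
by rewrite normr0 expr0n.
Qed.

(** The variables [X] are existentially hidden, one family per vector, while joint independence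
    speaks of the coordinates of [w]. On [C] the two coincide, so the properties of [X] pass to the
    coordinates. *)
Lemma probing_vectorE {disp : measure_display}
    {T : measurableType disp} {R : realType} (P : probability T R) n
    (C : {set 'I_n}) (w : T -> 'cV[R]_n) : rademacher_probing_vector P C w ->
  [/\ forall i, measurable_fun setT (fun t => w t i 0),
      independent_variables P C (fun i t => w t i 0),
      forall i, i \in C -> rademacher P (fun t => w t i 0) &
      forall i t, i \notin C -> w t i 0 = 0].
Proof.
move=> [X [indepX radX wX]].
have wE i t : w t i 0 = if i \in C then X i t else 0.
  rewrite wX summxE; case: ifPn => iC.
    rewrite (bigD1 i)//= !mxE !eqxx mulr1 big1 ?addr0// => j /andP[_ ji].
    by rewrite !mxE eq_sym (negbTE ji) mulr0.
  rewrite big1// => j jC; rewrite !mxE; case: eqP => [ij|]; rewrite ?mulr0//.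
  by rewrite ij jC in iC.
have wC i : i \in C -> (fun t => w t i 0) = X i.
  by move=> iC; apply/funext => t; rewrite wE iC.
split=> [i|J E JC JE|i iC|i t iC].
- have [iC|iC] := boolP (i \in C); first by rewrite wC.
  by under eq_fun do rewrite wE (negbTE iC); exact: measurable_cst.
- apply: indepX => // i iJ.
  by rewrite -wC; [exact: JE|exact: (fintype.subsetP JC)].
- by rewrite wC//; exact: radX.
- by rewrite wE (negbTE iC).
Qed.

Lemma quadratic_form_mulmx {R : numFieldType} n (C : {set 'I_n}) (M : 'M[R]_n)
    (v : 'cV[R]_n) : (forall i, i \notin C -> v i 0 = 0) ->
  (v^T *m M *m v) 0 0 = quadratic_form M C (v^~ 0).
Proof.
move=> v0; rewrite -mulmxA mxE /quadratic_form [RHS]big_mkcond/=.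
apply: eq_bigr => i _; rewrite !mxE; case: ifPn => [iC|/v0 ->]; last by rewrite mul0r.
rewrite [RHS]big_mkcond/= mulr_sumr; apply: eq_bigr => j _.
by case: ifPn => [jC|/v0 ->]; rewrite ?mulr0// mulrA (mulrC (v i 0)).
Qed.

(** * The variance of the probing estimator *)

Theorem lemma3p5 (disp : measure_display) (T : measurableType disp)
  (R : realType) (P : probability T R)
  (n : nat) (A : 'M[R]_n) (symA : A^T = A) (f : R -> R)
  (d : nat) (d_ge1 : (1 <= d)%N)
  (m : nat) (col : 'I_n -> 'I_m) (col_d : distance_coloring A d col)
  (N : 'I_m -> nat) (N_gt0 : forall l, (0 < N l)%N)
  (w : forall l : 'I_m, 'I_(N l) -> T -> 'cV[R]_n)
  (w_probing : forall l s,
     rademacher_probing_vector P (color_class col l) (w l s))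
  (w_indep : independent_vectors P
     (fun k : {l : 'I_m & 'I_(N l)} => w (tag k) (tagged k))) :
  let C := color_class col in
  let fA := matfun f A in
  let V := fun l =>
    2 * frobenius_norm (offdiag (principal_submx (C l) fA)) ^+ 2 in
  [/\ 'V_P[probing_estimator w fA] = (\sum_l V l / (N l)%:R)%:E,
      \sum_l V l / (N l)%:R =
        2 * \sum_l (N l)%:R^-1 *
              frobenius_norm (offdiag (principal_submx (C l) fA)) ^+ 2 &
      forall l, V l = 2 * \sum_(i in C l) \sum_(j in C l | i != j)
                            `|fA i j| ^+ 2].
Proof.
move=> C fA V; split; last 2 first.
- by rewrite mulr_sumr; apply: eq_bigr => l _; rewrite /V -mulrA (mulrC _^-1).
- by move=> l; rewrite /V frobenius_offdiag_principal.
pose K : finType := {l : 'I_m & 'I_(N l)}.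
pose ix l (s : 'I_(N l)) : K := Tagged (fun l => 'I_(N l)) s.
(* One index per sample and per vertex of its color class: these coordinates are Rademacher, the
   others identically 0. *)
pose D := [set x : K * 'I_n | x.2 \in C (tag x.1)]%SET.
pose B (x y : K * 'I_n) :=
  if x.1 == y.1 then (N (tag x.1))%:R^-1 * fA x.2 y.2 else 0.
have fAC i j : fA i j = fA j i by rewrite -{1}[fA](matfun_sym f symA) mxE.
have symB x y : B x y = B y x.
  by rewrite /B eq_sym; case: eqP => // ->; rewrite fAC.
have wP (k : K) := probing_vectorE (w_probing (tag k) (tagged k)).
have sumD F : \sum_(x in D) F x = \sum_k \sum_(i in C (tag k)) F (k, i) :> R.
  by rewrite pair_big_dep/=; apply: eq_big => -[k i]; rewrite ?inE.
(* For a summand supported on the block of sample [k], such as a row of [B], the sum over [D]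
   reduces to one color class. *)
have sumDk k F : (forall k' i, k' != k -> F (k', i) = 0) ->
    \sum_(x in D) F x = \sum_(i in C (tag k)) F (k, i) :> R.
  move=> F0; rewrite sumD (bigD1 k)//= [X in _ + X]big1 ?addr0// => k' k'k.
  by apply: big1 => i _; exact: F0.
have sumK F : \sum_(k : K) F k = \sum_l \sum_(s < N l) F (ix l s) :> R.
  by rewrite sig_big_dep/=; apply: eq_bigr => -[].
have -> : probing_estimator w fA = (fun t => quadratic_form B D
    (fun x => w (tag x.1) (tagged x.1) t x.2 0)).
  apply/funext => t; rewrite /quadratic_form sumD sumK.
  apply: eq_bigr => l _; rewrite mulr_sumr; apply: eq_bigr => s _.
  have [_ _ _ w0] := wP (ix _ s).
  rewrite (quadratic_form_mulmx (C := C l))//; last by move=> i; exact: w0.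
  rewrite mulr_sumr; apply: eq_bigr => i iC.
  rewrite (sumDk (ix _ s)) => [|k j /negPf]; last first.
    by rewrite /B/= eq_sym => ->; rewrite !mul0r.
  by rewrite mulr_sumr; apply: eq_bigr => j jC; rewrite /B/= eqxx !mulrA.
rewrite (variance_rademacher_quadratic_form (P := P)) => //.
- congr _%:E; rewrite sumD sumK mulr_sumr; apply: eq_bigr => l _.
  rewrite /V frobenius_offdiag_principal.
  (* Squaring the entries of [B] gives a factor [(N l)%:R ^- 2] per sample; the [N l] samples of
     color [l] together leave [(N l)%:R^-1]. *)
  rewrite (eq_bigr (fun=> (N l)%:R ^- 2 *
      \sum_(i in C l) \sum_(j in C l | i != j) `|fA i j| ^+ 2)); last first.
    move=> s _; rewrite mulr_sumr; apply: eq_bigr => i iC.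
    rewrite big_mkcondr/= (sumDk (ix _ s)) => [|k j /negPf]; last first.
      by rewrite /B/= eq_sym => ->; rewrite expr0n if_same.
    rewrite -big_mkcondr mulr_sumr; apply: eq_big => j.
      by rewrite xpair_eqE eqxx.
    by rewrite /B/= eqxx exprMn exprVn real_normK ?num_real.
  rewrite sumr_const card_ord -[X in 2 * X]mulr_natl.
  by field; rewrite pnatr_eq0 -lt0n.
- by move=> [k i]; have [mw _ _ _] := wP k; exact: mw.
(* Independence within a vector comes from [w_probing], independence across vectors from
   [w_indep]. *)
- apply: (@independent_variables_block _ _ _ _ K _ (fun k => C (tag k))
    (fun k => w (tag k) (tagged k))) => // k.
  by have [] := wP k.
- by move=> [k i]; rewrite inE /= => ?; have [_ _ rw _] := wP k; exact: rw.
Qed.
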